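(* Let $\zeta_3$ be a primitive cube root of unity. Then \[ \sum_{n=0}^\infty\sum_{m=-\infty}^\infty M2(m,n)\zeta_3^mq^n=M2_{0,3}(q^3)+qM2_{1,3}(q^3)+q^2M2_{2,3}(q^3), \] where \begin{align*} M2_{0,3}(q)&=\frac{(q^6;q^6)_\infty^{10}(q^4;q^4)_\infty(q;q)_\infty}{(q^{12};q^{12})_\infty^4(q^3;q^3)_\infty^4(q^2;q^2)_\infty^3},\qquad M2_{1,3}(q)=\frac{(q^6;q^6)_\infty^4}{(q^{12};q^{12})_\infty(q^3;q^3)_\infty(q^2;q^2)_\infty},\\ M2_{2,3}(q)&=-2\frac{(q^{12};q^{12})_\infty^2(q^3;q^3)_\infty^2(q^2;q^2)_\infty}{(q^6;q^6)_\infty^2(q^4;q^4)_\infty(q;q)_\infty}. \end{align*}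
   Context: $(a;q)_\infty=\prod_{k\ge0}(1-aq^k)$. The numbers $M2(m,n)$ are defined by \[ \sum_{n\ge0}\sum_mM2(m,n)z^mq^n=\frac{(-q;q^2)_\infty(q^2;q^2)_\infty}{(zq^2;q^2)_\infty(z^{-1}q^2;q^2)_\infty}. \] *)

(* Defs.v *)
From mathcomp Require Import all_boot all_order all_algebra all_field.
Set Implicit Arguments. Unset Strict Implicit. Unset Printing Implicit Defensive.
Import Order.TTheory GRing.Theory Num.Theory.
Local Open Scope ring_scope.

(* formal power series: the coefficient of q^n is f n *)
Definition ps (R : Type) := nat -> R.

Section PS.
Variable R : comNzRingType.

Definition psone : ps R := fun n => (n == 0)%:R.
Definition psadd (f g : ps R) : ps R := fun n => f n + g n.
Definition psscale (c : R) (f : ps R) : ps R := fun n => c * f n.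
Definition psmul (f g : ps R) : ps R :=
  fun n => \sum_(i < n.+1) f i * g (n - i)%N.
Definition pspow (f : ps R) (k : nat) : ps R := iter k (psmul f) psone.

(* Inverse of a series with constant term 1:
   g 0 = 1, g n = - sum_{i=1}^n f i * g (n - i). *)
Fixpoint psinv_aux (f : ps R) (n : nat) : seq R :=
  match n with
  | 0 => [:: 1]
  | n'.+1 =>
      let s := psinv_aux f n' in
      rcons s (- \sum_(j < n'.+1) f j.+1 * nth 0 s (n' - j)%N)
  end.
Definition psinv (f : ps R) : ps R := fun n => nth 0 (psinv_aux f n) n.

Definition psdilate (k : nat) (f : ps R) : ps R :=
  fun n => if (k %| n)%N then f (n %/ k)%N else 0.
Definition psshift (j : nat) (f : ps R) : ps R :=
  fun n => if (j <= n)%N then f (n - j)%N else 0.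

(* qpinf a s t = prod_{k >= 0} (1 - a q^(s k + t)) (used with s, t >= 1);
   the coefficient of q^n is that of the finite product over k <= n,
   since the remaining factors are 1 + O(q^(n+1)). *)
Definition qpinf (a : R) (s t : nat) : ps R :=
  fun n => (\prod_(k < n.+1) (1 - a *: ('X^(s * k + t) : {poly R})))`_n.

Definition Eta (k : nat) : ps R := qpinf 1 k k.
End PS.

(* Two-variable generating function: the coefficient ring Z[z, z^-1] is
   encoded as Z[z, w]/(zw - 1) via {poly {poly int}}: outer variable z,
   inner variable w standing for z^-1. *)
Definition R2 := {poly {poly int}}.
Definition zvar : R2 := 'X.
Definition wvar : R2 := ('X : {poly int})%:P.

Definition M2gen : ps R2 :=
  psmul (psmul (qpinf (-1) 2 1) (qpinf 1 2 2))
        (psmul (psinv (qpinf zvar 2 2)) (psinv (qpinf wvar 2 2))).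

Definition M2 (m : int) (n : nat) : int :=
  let P := M2gen n in
  \sum_(a < size P) \sum_(b < size P`_a)
     (if (a%:Z - b%:Z == m) then P`_a`_b else 0).

Section Thetas.
Variable R : comNzRingType.
Definition M2_03 : ps R :=
  psmul (psmul (psmul (pspow (Eta R 6) 10) (Eta R 4)) (Eta R 1))
        (psinv (psmul (psmul (pspow (Eta R 12) 4) (pspow (Eta R 3) 4))
                      (pspow (Eta R 2) 3))).
Definition M2_13 : ps R :=
  psmul (pspow (Eta R 6) 4)
        (psinv (psmul (psmul (Eta R 12) (Eta R 3)) (Eta R 2))).
Definition M2_23 : ps R :=
  psscale (-2) (psmul (psmul (psmul (pspow (Eta R 12) 2) (pspow (Eta R 3) 2)) (Eta R 2))
        (psinv (psmul (psmul (pspow (Eta R 6) 2) (Eta R 4)) (Eta R 1)))).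
End Thetas.

(* Main.v *)
(** With z a cube root of unity, (z q^2; q^2)(z^-1 q^2; q^2) = (q^6; q^6)/(q^2; q^2),
    so the left-hand side times (q^6; q^6) is (-q; q^2)(q^2; q^2)^2 = phi(q) psi(-q),
    with Ramanujan's theta functions.  The series phi and psi have two-term
    3-dissections, read off from their exponents; multiplying these out gives the
    three components.  The Jacobi triple product turns every theta series that occurs
    into an eta quotient, and the middle component collapses because
    f(q, q^5) f(-q, q^2) = phi(q^3) psi(-q^3). *)
Require Import Defs.
From HB Require Import structures.
From mathcomp Require Import all_boot all_order all_algebra all_field.
From mathcomp Require Import boolp ring zify.
Set Implicit Arguments. Unset Strict Implicit. Unset Printing Implicit Defensive.
Import Order.TTheory GRing.Theory Num.Theory.
Local Open Scope ring_scope.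

(** * The ring of formal power series *)

Section SeriesRing.
Variable R : comNzRingType.
Implicit Types (f g h : ps R) (p : {poly R}).

(** The eta quotients are verified without division. The auxiliary product (-q; q^2), called [N],
    and its dilate [N3] are eliminated by N E1 E4 = E2^2 and N3 E3 E12 = E6^2, where Ek stands for
    [Eta k]. A component identity is multiplied by [N] or [N3] until these relations apply, and the
    extra factors are then cancelled. This is allowed over any commutative nonzero ring, because
    every cancelled series has constant term 1. The components are treated after multiplication by
    E2: the left-hand side has to be multiplied by E6, which is the q^3-dilate of E2 and can
    therefore be moved inside each dilated component. The basic identities between infinite sums and
    products are q-adic limits of finite ones. *)

Definition trunc n f : {poly R} := \poly_(i < n.+1) f i.

Lemma coef_trunc n f i : (i <= n)%N -> (trunc n f)`_i = f i.
Proof. by rewrite coef_poly ltnS => ->. Qed.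

(** A coefficient of a product involves finitely many coefficients of the factors, so the ring laws
    can be borrowed from polynomials. *)
Lemma psmul_trunc n f g i :
  (i <= n)%N -> psmul f g i = (trunc n f * trunc n g)`_i.
Proof.
move=> le_in; rewrite coefM; apply: eq_bigr => j _.
by rewrite !coef_trunc //; have := ltn_ord j; lia.
Qed.

Lemma psmulC : commutative (@psmul R).
Proof.
by move=> f g; apply: funext => n; rewrite !(@psmul_trunc n) // mulrC.
Qed.

Lemma psmulA : associative (@psmul R).
Proof.
move=> f g h; apply: funext => n.
have -> : psmul f (psmul g h) n = (trunc n f * (trunc n g * trunc n h))`_n.
  rewrite coefM; apply: eq_bigr => j _.
  by rewrite coef_trunc -1?psmul_trunc //; have := ltn_ord j; lia.
rewrite mulrA coefM; apply: eq_bigr => j _.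
by rewrite coef_trunc -1?psmul_trunc //; have := ltn_ord j; lia.
Qed.

Lemma psmul1 : left_id (@psone R) (@psmul R).
Proof.
move=> f; apply: funext => n; rewrite /psmul big_ord_recl /psone /= mul1r subn0.
by rewrite big1 ?addr0 // => i _; rewrite mul0r.
Qed.

Lemma psmulDl : left_distributive (@psmul R) (@psadd R).
Proof.
move=> f g h; apply: funext => n; rewrite /psmul /psadd -big_split /=.
by apply: eq_bigr => i _; rewrite mulrDl.
Qed.

Definition pszero : ps R := fun=> 0.
Definition psopp f : ps R := fun n => - f n.

Lemma psaddA : associative (@psadd R).
Proof. by move=> f g h; apply: funext => n; rewrite /psadd addrA. Qed.
Lemma psaddC : commutative (@psadd R).
Proof. by move=> f g; apply: funext => n; rewrite /psadd addrC. Qed.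
Lemma psadd0 : left_id pszero (@psadd R).
Proof. by move=> f; apply: funext => n; rewrite /psadd add0r. Qed.
Lemma psaddN : left_inverse pszero psopp (@psadd R).
Proof. by move=> f; apply: funext => n; rewrite /psadd addNr. Qed.

Lemma psone_neq0 : (@psone R : ps R) <> pszero.
Proof. by move/(congr1 (@^~ 0%N))/eqP; rewrite oner_eq0. Qed.
End SeriesRing.

HB.instance Definition _ (R : comNzRingType) := gen_eqMixin (ps R).
HB.instance Definition _ (R : comNzRingType) := gen_choiceMixin (ps R).
HB.instance Definition _ (R : comNzRingType) :=
  GRing.isZmodule.Build (ps R) (@psaddA R) (@psaddC R) (@psadd0 R) (@psaddN R).
Fact psone_neq0b (R : comNzRingType) : (@psone R : ps R) != 0.
Proof. by apply/eqP; exact: psone_neq0. Qed.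
HB.instance Definition _ (R : comNzRingType) :=
  GRing.Zmodule_isComNzRing.Build (ps R) (@psmulA R) (@psmulC R) (@psmul1 R)
    (@psmulDl R) (psone_neq0b R).

Section Basic.
Variable R : comNzRingType.
Implicit Types (f g h : ps R) (p : {poly R}).

Lemma ps1E n : (1 : ps R) n = (n == 0)%:R. Proof. by []. Qed.
Lemma psDE f g n : (f + g) n = f n + g n. Proof. by []. Qed.
Lemma psNE f n : (- f) n = - f n. Proof. by []. Qed.
Lemma psBE f g n : (f - g) n = f n - g n. Proof. by []. Qed.
Lemma psME f g n : (f * g) n = \sum_(i < n.+1) f i * g (n - i)%N.
Proof. by []. Qed.
Lemma psM0E f g : (f * g) 0 = f 0 * g 0.
Proof. by rewrite psME big_ord1. Qed.
Lemma psX0E f k : (f ^+ k) 0 = f 0 ^+ k.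
Proof. by elim: k => // k IH; rewrite !exprS psM0E IH. Qed.
Lemma pspowE f k : pspow f k = f ^+ k.
Proof. by elim: k => // k IH; rewrite exprS -IH. Qed.

Definition pspoly p : ps R := fun n => p`_n.
Fact pspoly_zmod : zmod_morphism pspoly.
Proof. by move=> p r; apply: funext => n; rewrite /pspoly coefB. Qed.
Fact pspoly_monoid : monoid_morphism pspoly.
Proof.
split; first by apply: funext => n; rewrite /pspoly coef1.
by move=> p r; apply: funext => n; rewrite /pspoly coefM.
Qed.
HB.instance Definition _ := GRing.isZmodMorphism.Build _ _ pspoly pspoly_zmod.
HB.instance Definition _ :=
  GRing.isMonoidMorphism.Build _ _ pspoly pspoly_monoid.

Definition psX : ps R := pspoly 'X.

Lemma psXnE k n : (psX ^+ k) n = (n == k)%:R.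
Proof. by rewrite -rmorphXn /= /pspoly coefXn. Qed.

Lemma psXnM k f n : (psX ^+ k * f) n = if (k <= n)%N then f (n - k)%N else 0.
Proof.
rewrite psME; case: leqP => [le_kn|lt_nk].
  rewrite (bigD1 (Ordinal (le_kn : k < n.+1)%N)) //= psXnE eqxx mul1r.
  rewrite big1 ?addr0 // => i /eqP ne_ik; rewrite psXnE.
  by case: eqP => [e|_]; [case: ne_ik; apply: val_inj | rewrite mul0r].
rewrite big1 // => i _; rewrite psXnE; case: eqP => [e|]; last by rewrite mul0r.
by have := ltn_ord i; lia.
Qed.

Lemma psshiftE k f : psshift k f = psX ^+ k * f.
Proof. by apply: funext => n; rewrite psXnM. Qed.

Lemma psXn_inj k : injective (fun f => psX ^+ k * f).
Proof.
move=> f g /= e; apply: funext => n; have := congr1 (@^~ (k + n)%N) e.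
by rewrite /= !psXnM leq_addr addKn.
Qed.

Definition psC c : ps R := pspoly c%:P.
Fact psC_zmod : zmod_morphism psC.
Proof. by move=> a b; rewrite /psC polyCB rmorphB. Qed.
Fact psC_monoid : monoid_morphism psC.
Proof. by split=> [|a b]; rewrite /psC ?polyC1 ?rmorph1 // polyCM rmorphM. Qed.
HB.instance Definition _ := GRing.isZmodMorphism.Build _ _ psC psC_zmod.
HB.instance Definition _ := GRing.isMonoidMorphism.Build _ _ psC psC_monoid.

Lemma psCE c f n : (psC c * f) n = c * f n.
Proof.
rewrite psME big_ord_recl /= /psC /pspoly coefC /= subn0 big1 ?addr0 // => i _.
by rewrite coefC /= mul0r.
Qed.
Lemma psscaleE c f : psscale c f = psC c * f.
Proof. by apply: funext => n; rewrite psCE. Qed.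

Lemma size_psinv_aux f n : size (psinv_aux f n) = n.+1.
Proof. by elim: n => //= n IH; rewrite size_rcons IH. Qed.

Lemma nth_psinv_aux f n m :
  (m <= n)%N -> nth 0 (psinv_aux f n) m = psinv f m.
Proof.
elim: n => [|n IH]; first by case: m.
rewrite leq_eqVlt => /orP[/eqP-> //|lt_mn] /=.
by rewrite nth_rcons size_psinv_aux lt_mn IH.
Qed.

Lemma psinvS f n :
  psinv f n.+1 = - \sum_(j < n.+1) f j.+1 * psinv f (n - j)%N.
Proof.
rewrite {1}/psinv /= nth_rcons size_psinv_aux ltnn eqxx; congr (- _).
by apply: eq_bigr => j _; rewrite nth_psinv_aux // leq_subr.
Qed.

Lemma psmulV f : f 0 = 1 -> f * psinv f = 1.
Proof.
move=> f0; apply: funext => -[|n]; rewrite psME.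
  by rewrite big_ord1 f0 mul1r ps1E.
rewrite big_ord_recl f0 mul1r subn0 psinvS.
by apply/eqP; rewrite addrC subr_eq0; apply/eqP/eq_bigr => j _.
Qed.

(** The cancellation rule behind all eta-quotient identities: constant term 1 gives an inverse,
    whatever zero divisors [R] may have. *)
Lemma psmulI f : f 0 = 1 -> injective ( *%R f).
Proof.
move=> f0 g h e; have fV := psmulV f0.
by rewrite -[g]mul1r -[h]mul1r -fV ![f * _]mulrC -!mulrA e.
Qed.

Lemma psinv_eq f g : f 0 = 1 -> f * g = 1 -> g = psinv f.
Proof. by move=> f0 fg; apply: (psmulI f0); rewrite psmulV. Qed.

Fact psdilate_zmod k : zmod_morphism (@psdilate R k).
Proof.
move=> f g; apply: funext => n; rewrite [RHS]psBE /psdilate.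
by case: ifP; rewrite // subr0.
Qed.

Lemma psdilate_trunc k f n i : (0 < k)%N -> (i <= n)%N ->
  psdilate k f i = (trunc n f \Po 'X^k)`_i.
Proof.
move=> k0 le_in; rewrite coef_comp_poly_Xn // /psdilate; case: ifP => // _.
by rewrite coef_trunc //; apply: leq_trans (leq_div _ _) le_in.
Qed.

Lemma psdilateM k f g : (0 < k)%N ->
  psdilate k (f * g) = psdilate k f * psdilate k g.
Proof.
move=> k0; apply: funext => n.
rewrite [RHS]psME.
transitivity (((trunc n f * trunc n g) \Po 'X^k)`_n).
  rewrite coef_comp_poly_Xn // /psdilate; case: ifP => // _.
  by apply: psmul_trunc; apply: leq_div.
rewrite rmorphM /= coefM; apply: eq_bigr => j _.
by rewrite -!psdilate_trunc //; have := ltn_ord j; lia.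
Qed.

(** Indexing by [k.+1] builds positivity into the instance, which therefore applies to literals such
    as 3. *)
Fact psdilate_monoid k : monoid_morphism (@psdilate R k.+1).
Proof.
split; last by move=> f g; apply: psdilateM.
apply: funext => n; rewrite /psdilate ps1E; case: n => [|n] //.
case: ifP => // k_n; rewrite ps1E eqn0Ngt divn_gt0 //.
by rewrite dvdn_leq.
Qed.
HB.instance Definition _ k :=
  GRing.isZmodMorphism.Build _ _ (@psdilate R k) (psdilate_zmod k).
HB.instance Definition _ k :=
  GRing.isMonoidMorphism.Build _ _ (@psdilate R k.+1) (psdilate_monoid k).

(** The substitution q -> -q. *)
Definition psneg f : ps R := fun n => (-1) ^+ n * f n.
Fact psneg_zmod : zmod_morphism psneg.
Proof. by move=> f g; apply: funext => n; rewrite /psneg psBE mulrBr. Qed.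
Fact psneg_monoid : monoid_morphism psneg.
Proof.
split=> [|f g]; apply: funext => n.
  by rewrite /psneg ps1E; case: n => [|n]; rewrite ?mul1r ?mulr0.
rewrite /psneg !psME mulr_sumr; apply: eq_bigr => i _.
have -> : (-1) ^+ n = (-1) ^+ i * (-1) ^+ (n - i) :> R.
  by rewrite -exprD subnKC // leq_ord.
by rewrite mulrACA.
Qed.
HB.instance Definition _ := GRing.isZmodMorphism.Build _ _ psneg psneg_zmod.
HB.instance Definition _ := GRing.isMonoidMorphism.Build _ _ psneg psneg_monoid.

Lemma psdilateX k : psdilate k.+1 psX = psX ^+ k.+1.
Proof.
apply: funext => n; rewrite psXnE /psdilate /psX /pspoly coefX.
case: (boolP (k.+1 %| n)%N) => [/dvdnP[m ->]|ndv].
  by rewrite mulnK // -{2}[k.+1]mul1n eqn_pmul2r.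
by case: eqP => // e; rewrite e dvdnn in ndv.
Qed.

Lemma psnegX : psneg psX = - psX.
Proof.
apply: funext => n; rewrite psNE /psneg /psX /pspoly coefX.
by case: eqP => [->|]; rewrite ?mulr0 ?oppr0 // mulN1r.
Qed.

Lemma psneg_dilate k f : odd k -> psneg (psdilate k f) = psdilate k (psneg f).
Proof.
move=> ok; apply: funext => n; rewrite /psneg /psdilate.
case: ifP => [/dvdnP[m ->]|]; last by rewrite mulr0.
rewrite mulnK ?(odd_gt0 ok) // -signr_odd oddM ok andbT.
by rewrite signr_odd.
Qed.
End Basic.

(** * Convergence and infinite products *)

Section Convergence.
Variable R : comNzRingType.
Implicit Types (f g h : ps R) (u v : nat -> ps R) (N : nat).

(** Congruence modulo q^N; [cvg] below is convergence in the q-adic topology. *)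
Definition eqm N f g := forall i, (i < N)%N -> f i = g i.

Lemma eqm_sym N f g : eqm N f g -> eqm N g f.
Proof. by move=> e i /e. Qed.

Lemma eqm_trans N f g h : eqm N f g -> eqm N g h -> eqm N f h.
Proof. by move=> e1 e2 i lt_iN; rewrite e1 ?e2. Qed.

Lemma eqmW N N' f g : (N <= N')%N -> eqm N' f g -> eqm N f g.
Proof. by move=> le_NN e i lt_iN; apply: e; apply: leq_trans le_NN. Qed.

Lemma eqmD N f f' g g' : eqm N f f' -> eqm N g g' -> eqm N (f + g) (f' + g').
Proof. by move=> e1 e2 i lt_iN; rewrite !psDE e1 ?e2. Qed.

Lemma eqmM N f f' g g' : eqm N f f' -> eqm N g g' -> eqm N (f * g) (f' * g').
Proof.
move=> e1 e2 i lt_iN; rewrite !psME; apply: eq_bigr => j _.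
by rewrite e1 ?e2 //; have := ltn_ord j; lia.
Qed.

Lemma eqm_mull N h f g : eqm N f g -> eqm N (h * f) (h * g).
Proof. exact: eqmM. Qed.

Lemma eqm_mulI N h f g : h 0 = 1 -> eqm N (h * f) (h * g) -> eqm N f g.
Proof.
move=> h0 /(eqm_mull (psinv h)).
by rewrite !mulrA ![psinv h * h]mulrC psmulV // !mul1r.
Qed.

Lemma eqm_Xn N k f : (N <= k)%N -> eqm N (f * psX R ^+ k) 0.
Proof. by move=> le_Nk i lt_iN; rewrite mulrC psXnM leqNgt (leq_trans lt_iN). Qed.

Definition cvg u f := forall N, exists M, forall m, (M <= m)%N -> eqm N (u m) f.

Lemma cvg_uniq u f g : cvg u f -> cvg u g -> f = g.
Proof.
move=> cf cg; apply: funext => n.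
have [[M hM] [M' hM']] := (cf n.+1, cg n.+1).
by rewrite -(hM (maxn M M')) ?leq_maxl // -(hM' (maxn M M')) ?leq_maxr.
Qed.

Lemma cvg_cst f : cvg (fun=> f) f.
Proof. by move=> N; exists 0. Qed.

Lemma cvg_ext u v f : u =1 v -> cvg u f -> cvg v f.
Proof. by move=> /funext ->. Qed.

Lemma cvgD u v f g : cvg u f -> cvg v g -> cvg (fun m => u m + v m) (f + g).
Proof.
move=> cf cg N; have [[M hM] [M' hM']] := (cf N, cg N).
by exists (maxn M M') => m; rewrite geq_max => /andP[/hM ? /hM' ?]; apply: eqmD.
Qed.

Lemma cvgM u v f g : cvg u f -> cvg v g -> cvg (fun m => u m * v m) (f * g).
Proof.
move=> cf cg N; have [[M hM] [M' hM']] := (cf N, cg N).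
by exists (maxn M M') => m; rewrite geq_max => /andP[/hM ? /hM' ?]; apply: eqmM.
Qed.

Lemma cvgN u f : cvg u f -> cvg (fun m => - u m) (- f).
Proof.
move=> cf N; have [M hM] := cf N; exists M => m /hM e i /e ei.
by rewrite !psNE ei.
Qed.

Lemma cvg_sum n (u : nat -> nat -> ps R) (f : nat -> ps R) :
  (forall k, cvg (u ^~ k) (f k)) ->
  cvg (fun m => \sum_(k < n) u m k) (\sum_(k < n) f k).
Proof.
move=> cu; elim: n => [|n IH].
  by rewrite big_ord0; apply: cvg_ext (cvg_cst 0) => m; rewrite big_ord0.
rewrite big_ord_recr; apply: cvg_ext (cvgD IH (cu n)) => m.
by rewrite big_ord_recr.
Qed.

Lemma cvg_prod n (u : nat -> nat -> ps R) (f : nat -> ps R) :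
  (forall k, cvg (u ^~ k) (f k)) ->
  cvg (fun m => \prod_(k < n) u m k) (\prod_(k < n) f k).
Proof.
move=> cu; elim: n => [|n IH].
  by rewrite big_ord0; apply: cvg_ext (cvg_cst 1) => m; rewrite big_ord0.
rewrite big_ord_recr; apply: cvg_ext (cvgM IH (cu n)) => m.
by rewrite big_ord_recr.
Qed.

Lemma cvg_sub (e : nat -> nat) u f :
  (forall m, m <= e m)%N -> cvg u f -> cvg (u \o e) f.
Proof.
move=> le_e cf N; have [M hM] := cf N; exists M => m le_Mm.
by apply: hM; apply: leq_trans (le_e m).
Qed.

Lemma cvg_eqm u f : (forall N m, (N <= m)%N -> eqm N (u m) f) -> cvg u f.
Proof. by move=> h N; exists N => m; apply: h. Qed.

Lemma cvg_dilate k u f : cvg u f -> cvg (psdilate k \o u) (psdilate k f).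
Proof.
move=> cf N; have [M hM] := cf N; exists M => m /hM e i lt_iN.
rewrite /psdilate /=; case: ifP => // _; apply: e.
by apply: leq_ltn_trans lt_iN; apply: leq_div.
Qed.

Lemma cvg_neg u f : cvg u f -> cvg (@psneg R \o u) (psneg f).
Proof.
by move=> cf N; have [M hM] := cf N; exists M => m /hM e i /e; rewrite /psneg /= => ->.
Qed.

(** Stopping after [n.+1] terms gives the infinite sum when the term of index k is O(q^k), the
    hypothesis of [eqm_isum] and [cvg_isum]. *)
Definition isum (F : nat -> ps R) : ps R := fun n => (\sum_(k < n.+1) F k) n.

Lemma eqm_isum (F : nat -> ps R) N m : (forall k, eqm k (F k) 0) ->
  (N <= m)%N -> eqm N (\sum_(k < m) F k) (isum F).
Proof.
move=> F0 le_Nm i lt_iN; rewrite /isum.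
rewrite -(subnKC (leq_trans lt_iN le_Nm)); move: (m - _)%N => d.
elim: d => [|d IH]; first by rewrite addn0.
by rewrite addnS big_ord_recr /= psDE IH F0 ?addr0 // leq_addr.
Qed.

Lemma cvg_isum (F : nat -> ps R) : (forall k, eqm k (F k) 0) ->
  cvg (fun m => \sum_(k < m) F k) (isum F).
Proof. by move=> F0; apply: cvg_eqm => N m; apply: eqm_isum. Qed.

(* Tannery: termwise limits may be taken because the k-th term is O(q^k). *)
Lemma cvg_isum_weight (F : nat -> ps R) (w : nat -> nat -> ps R) :
    (forall k, eqm k (F k) 0) -> (forall k, cvg (w ^~ k) 1) ->
  cvg (fun m => \sum_(k < m.+1) w m k * F k) (isum F).
Proof.
move=> F0 cw N.
have [M hM] : exists M, forall m, (M <= m)%N ->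
    eqm N (\sum_(k < N) w m k * F k) (\sum_(k < N) F k).
  apply: (@cvg_sum N (fun m k => w m k * F k) F) => k.
  by have := cvgM (cw k) (cvg_cst (F k)); rewrite mul1r.
exists (maxn N M) => m; rewrite geq_max => /andP[le_Nm le_Mm].
apply: eqm_trans (eqm_isum F0 (leqnn N)).
apply: eqm_trans (hM _ le_Mm) => i lt_iN.
rewrite -(subnKC (leqW le_Nm)); move: (m.+1 - N)%N => d.
elim: d => [|d IH]; first by rewrite addn0.
have wF0 : eqm N (w m (N + d)%N * F (N + d)%N) 0.
  rewrite -[X in eqm _ _ X](mulr0 (w m (N + d)%N)); apply: eqm_mull.
  by apply: eqmW (F0 _); apply: leq_addr.
by rewrite addnS big_ord_recr /= psDE IH wF0 // addr0.
Qed.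
End Convergence.

(** Indices are sorted by their residue modulo r; this serves both the splitting of infinite
    products and that of theta series. *)
Lemma big_ord_mul (T : Type) (idx : T) (op : Monoid.com_law idx) r m
    (F : nat -> T) :
  \big[op/idx]_(k < r * m) F k =
  \big[op/idx]_(j < r) \big[op/idx]_(i < m) F (r * i + j)%N.
Proof.
elim: m => [|m IH].
  by rewrite muln0 big_ord0 big1 // => j _; rewrite big_ord0.
rewrite mulnSr big_split_ord /= IH -big_split /=; apply: eq_bigr => j _.
by rewrite big_ord_recr.
Qed.

(** * Infinite q-products *)

Section Products.
Variable R : comNzRingType.
Implicit Types (a b : R) (s t m : nat).
Local Notation q := (psX R).

Definition qfac a e : ps R := 1 - psC a * q ^+ e.
Definition qpoch a s t m : ps R := \prod_(k < m) qfac a (s * k + t).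

Lemma qpoch_poly a s t m :
  qpoch a s t m = pspoly (\prod_(k < m) (1 - a *: 'X^(s * k + t))).
Proof.
rewrite rmorph_prod; apply: eq_bigr => k _.
by rewrite rmorphB rmorph1 -mul_polyC rmorphM rmorphXn.
Qed.

Lemma qpochS a s t m :
  qpoch a s t m.+1 = qpoch a s t m * qfac a (s * m + t).
Proof. by rewrite /qpoch big_ord_recr. Qed.

Lemma qpoch_eqm a s t N m :
  (0 < s)%N -> (N <= m)%N -> eqm N (qpoch a s t m) (qpinf a s t).
Proof.
move=> s0 le_Nm i lt_iN.
have -> : qpinf a s t i = qpoch a s t i.+1 i by rewrite qpoch_poly.
rewrite -(subnKC (leq_trans lt_iN le_Nm)); move: (m - _)%N => d.
elim: d => [|d IH]; first by rewrite addn0.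
rewrite addnS qpochS /qfac mulrBr mulr1 psBE IH mulrA.
(* Since s >= 1, every factor beyond the first [i.+1] is 1 + O(q^(i+1)). *)
have /(@eqm_Xn _ i.+1 _ (qpoch a s t (i.+1 + d) * psC a)) -> // :
  (i.+1 <= s * (i.+1 + d) + t)%N by nia.
by rewrite subr0.
Qed.

Lemma qpoch_cvg a s t : (0 < s)%N -> cvg (qpoch a s t) (qpinf a s t).
Proof. by move=> s0; apply: cvg_eqm => N m; apply: qpoch_eqm. Qed.

Lemma qpinf0 a s t : (0 < t)%N -> qpinf a s t 0 = 1.
Proof.
move=> t0; rewrite /qpinf big_ord1 coefB coef1 coefZ coefXn muln0 add0n.
by case: t t0 => // t _; rewrite mulr0 subr0.
Qed.

Lemma Eta0 k : (0 < k)%N -> Eta R k 0 = 1.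
Proof. exact: qpinf0. Qed.

Lemma qpinf_split r a s t : (0 < r)%N -> (0 < s)%N ->
  qpinf a s t = \prod_(j < r) qpinf a (r * s) (s * j + t).
Proof.
move=> r0 s0; have h := cvg_sub (fun m => leq_pmull m r0) (qpoch_cvg a t s0).
apply: cvg_uniq h _.
apply: (@cvg_ext _ (fun m => \prod_(j < r) qpoch a (r * s) (s * j + t) m)).
  move=> m; rewrite /= {2}/qpoch (big_ord_mul _ _ _ (fun k => qfac a (s * k + t))).
  by apply: eq_bigr => j _; apply: eq_bigr => i _; congr qfac; lia.
apply: (@cvg_prod _ r (fun m j => qpoch a (r * s) (s * j + t) m)
  (fun j => qpinf a (r * s) (s * j + t))) => j.
by apply: qpoch_cvg; rewrite muln_gt0 r0.
Qed.

Lemma qpinfNM a s t : (0 < s)%N ->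
  qpinf a s t * qpinf (- a) s t = qpinf (a ^+ 2) (2 * s) (2 * t).
Proof.
move=> s0; have s20 : (0 < 2 * s)%N by rewrite muln_gt0.
have h := (cvgM (qpoch_cvg a t s0) (qpoch_cvg (- a) t s0)).
apply: cvg_uniq h _.
apply: cvg_ext (qpoch_cvg (a ^+ 2) (2 * t) s20) => m.
rewrite -big_split; apply: eq_bigr => k _.
rewrite /= /qfac -mulnA -mulnDr mulnC exprM.
rewrite rmorphN rmorphXn /=; ring.
Qed.

Lemma qpinf_cube (w : R) s t : (0 < s)%N -> 1 + w + w ^+ 2 = 0 ->
  qpinf w s t * qpinf (w ^+ 2) s t * qpinf 1 s t = qpinf 1 (3 * s) (3 * t).
Proof.
move=> s0 w3; have s30 : (0 < 3 * s)%N by rewrite muln_gt0.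
have h := (cvgM (cvgM (qpoch_cvg w t s0) (qpoch_cvg (w ^+ 2) t s0))
  (qpoch_cvg 1 t s0)).
apply: cvg_uniq h _.
apply: cvg_ext (qpoch_cvg 1 (3 * t) s30) => m.
rewrite -!big_split; apply: eq_bigr => k _.
rewrite /= /qfac -mulnA -mulnDr mulnC exprM.
have W3 : 1 + psC w + psC w ^+ 2 = 0.
  by have := congr1 (@psC R) w3; rewrite !rmorphD rmorphXn rmorph1 rmorph0.
rewrite rmorphXn rmorph1 /=.
move: (q ^+ _) (psC w) W3 => x W W3.
(* Expanding, 1 - x^3 minus the product of the three factors is 1 + W + W^2 times the cofactor
   below; the last term of the cofactor comes from W^3 - 1 = (W - 1)(1 + W + W^2). *)
apply/eqP; rewrite -subr_eq0.
rewrite [X in X == 0](_ : _ = (1 + W + W ^+ 2) *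
  (x - W * x ^+ 2 + (W - 1) * x ^+ 3)); first by rewrite W3 mul0r.
by ring.
Qed.

Lemma psdilateC k a : psdilate k (psC a) = psC a.
Proof.
apply: funext => n; rewrite /psdilate /psC /pspoly !coefC.
case: n => [|n]; first by rewrite dvdn0 div0n.
case: ifP => // /dvdnP[m e]; rewrite e; case: k e => [|k] e; first by rewrite muln0 in e.
by rewrite mulnK //; case: m e.
Qed.

Lemma psnegC a : psneg (psC a) = psC a.
Proof.
apply: funext => n; rewrite /psneg /psC /pspoly !coefC.
by case: n => [|n]; rewrite ?mul1r ?mulr0.
Qed.

Lemma psdilate_qpinf k a s t : (0 < k)%N -> (0 < s)%N ->
  psdilate k (qpinf a s t) = qpinf a (k * s) (k * t).
Proof.
case: k => // k _ s0; have s20 : (0 < k.+1 * s)%N by rewrite muln_gt0.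
apply: cvg_uniq (cvg_dilate k.+1 (qpoch_cvg a t s0)) _.
apply: cvg_ext (qpoch_cvg a (k.+1 * t) s20) => m.
rewrite /= /qpoch rmorph_prod; apply: eq_bigr => i _.
rewrite /qfac rmorphB rmorph1 rmorphM rmorphXn /= psdilateX psdilateC -exprM.
by rewrite -mulnA -mulnDr.
Qed.

Lemma psdilate_Eta k l : (0 < k)%N -> (0 < l)%N ->
  psdilate k (Eta R l) = Eta R (k * l).
Proof. exact: psdilate_qpinf. Qed.

(** For even s all exponents s k + t have the parity of t, so every factor acquires the same
    sign. *)
Lemma psneg_qpinf a s t : (0 < s)%N -> ~~ odd s ->
  psneg (qpinf a s t) = qpinf ((-1) ^+ t * a) s t.
Proof.
move=> s0 es; have h := (cvg_neg (qpoch_cvg a t s0)).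
apply: cvg_uniq h _.
apply: cvg_ext (qpoch_cvg _ t s0) => m.
rewrite /= /qpoch rmorph_prod; apply: eq_bigr => i _.
rewrite /qfac rmorphB rmorph1 !rmorphM !rmorphXn /= psnegX psnegC rmorphN rmorph1.
rewrite [(- q) ^+ _]exprNn -[(-1) ^+ (_ + _)]signr_odd oddD oddM (negPf es).
by rewrite signr_odd mulrCA mulrA.
Qed.
End Products.

(** * The Jacobi triple product *)

Section QBinomial.
Variables (A : comNzRingType) (Q : A).

(** The Gaussian binomial, given by a Pascal rule because [A] offers no division by 1 - Q^k. The
    truncated subtraction [m' - j'] is harmless: when j' > m' it multiplies a zero coefficient, by
    [qbin_small]. *)
Fixpoint qbin m j : A :=
  match m, j with
  | _, 0 => 1
  | 0, _.+1 => 0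
  | m'.+1, j'.+1 => qbin m' j + Q ^+ (m' - j') * qbin m' j'
  end.

Lemma qbin0 m : qbin m 0 = 1. Proof. by case: m. Qed.

Lemma qbinS m j :
  qbin m.+1 j.+1 = qbin m j.+1 + Q ^+ (m - j) * qbin m j.
Proof. by []. Qed.

Lemma qbin_small m j : (m < j)%N -> qbin m j = 0.
Proof.
elim: m j => [|m IH] [|j] //= lt_mj.
by rewrite !IH ?mulr0 ?addr0 //; lia.
Qed.

Arguments qbin : simpl never.

Lemma qbinn m : qbin m m = 1.
Proof. by elim: m => // m IH; rewrite qbinS qbin_small // subnn IH add0r mulr1. Qed.

Lemma rothe (x y : A) m :
  \prod_(k < m) (y + x * Q ^+ k) =
  \sum_(j < m.+1) qbin m j * Q ^+ 'C(j, 2) * x ^+ j * y ^+ (m - j).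
Proof.
elim: m => [|m IH].
  by rewrite big_ord0 big_ord1 qbin0 !expr0 !mulr1.
rewrite big_ord_recr /= {}IH mulrDr [RHS]big_ord_recl /= bin0n /=.
rewrite [X in X + _]big_distrl [X in _ + X]big_distrl /=.
under [in RHS]eq_bigr => j _ do rewrite /bump add1n qbinS !mulrDl.
rewrite big_split /= addrA; congr (_ + _); last first.
  apply: eq_bigr => j _; have := ltn_ord j; rewrite ltnS => le_jm.
  rewrite binS bin1 subSS exprD !exprS.
  (* One part of Q^m is the weight in the Pascal rule, the other raises C(j, 2) to C(j+1, 2). *)
  have -> : Q ^+ m = Q ^+ (m - j) * Q ^+ j by rewrite -exprD subnK.
  ring.
rewrite big_ord_recl /= bin0n qbin0 [in RHS]big_ord_recr /= (@qbin_small m m.+1) //.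
rewrite !mul0r addr0.
congr (_ + _); first by rewrite subn0 exprSr !expr0 !mulr1 !mul1r.
apply: eq_bigr => j _; rewrite /bump /= !add1n -mulrA -exprSr.
by congr (_ * _ ^+ _); have := ltn_ord j; lia.
Qed.

Lemma qbin_fact m j : (j <= m)%N ->
  qbin m j * (\prod_(k < j) (1 - Q ^+ k.+1)) * (\prod_(k < m - j) (1 - Q ^+ k.+1))
  = \prod_(k < m) (1 - Q ^+ k.+1).
Proof.
elim: m j => [|m IH] [|j] // le_jm.
- by rewrite !big_ord0 !mulr1.
- by rewrite qbin0 big_ord0 !mul1r.
rewrite qbinS subSS; rewrite ltnS in le_jm.
have [lt_jm|] := ltnP j m; last first.
  move=> le_mj; have -> : j = m by lia.
  by rewrite qbin_small // qbinn subnn !big_ord0 add0r !mulr1 mul1r.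
have h1 := IH j.+1 lt_jm; have h2 := IH j le_jm.
move: h1 h2; rewrite (_ : m - j = (m - j.+1).+1)%N; last by lia.
rewrite !big_ord_recr /= => h1 h2.
have -> : Q ^+ m.+1 = Q ^+ (m - j.+1).+1 * Q ^+ j.+1.
  by rewrite -exprD; congr (_ ^+ _); lia.
move: h1 h2.
set P1 := \prod_(k < j) _; set P2 := \prod_(k < _ - _) _; set P := \prod_(k < m) _.
set b := Q ^+ j.+1; set a := Q ^+ _ => h1 h2.
(* This rests on 1 - a b = (1 - a) + a (1 - b), one induction hypothesis for each summand. *)
transitivity (qbin m j.+1 * (P1 * (1 - b)) * P2 * (1 - a)
   + a * (1 - b) * (qbin m j * P1 * (P2 * (1 - a)))); first by ring.
by rewrite h1 h2; ring.
Qed.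
End QBinomial.

Section JacobiTriple.
Variable R : comNzRingType.
Local Notation q := (psX R).

Definition hexp s t k := (s * 'C(k, 2) + t * k)%N.

(** For 0 < t < s this is the half k >= 0 of Ramanujan's f(q^t, q^(s-t)). Since C(-k, 2) = C(k, 2) +
    k, the other half is the same series with s - t for t. Both halves contain the term 1, whence
    the [- 1] in every two-sided theta series. *)
Definition ptheta s t : ps R := isum (fun k => q ^+ hexp s t k).

Lemma hexp_ge s t k : (0 < t)%N -> (k <= hexp s t k)%N.
Proof. by rewrite /hexp => t0; nia. Qed.

Lemma ptheta_eqm0 s t k : (0 < t)%N -> eqm k (q ^+ hexp s t k) 0.
Proof. by move=> t0; rewrite -[q ^+ _]mul1r; apply: eqm_Xn; apply: hexp_ge. Qed.

Lemma binS2 n : 'C(n.+1, 2) = ('C(n, 2) + n)%N.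
Proof. by rewrite binS bin1. Qed.

Lemma binD2 m n : 'C(m + n, 2) = ('C(m, 2) + 'C(n, 2) + m * n)%N.
Proof. by elim: n => [|n IH]; rewrite ?addn0 ?muln0 ?addn0 // addnS !binS2 IH; lia. Qed.

Lemma bin2_sqr n : (2 * 'C(n, 2) + n = n * n)%N.
Proof. by elim: n => // n IH; rewrite binS2; lia. Qed.

Lemma big_ord_sym (V : zmodType) (F : nat -> V) n :
  \sum_(j < (n + n).+1) F j =
  \sum_(k < n.+1) F (n + k)%N + \sum_(k < n.+1) F (n - k)%N - F n.
Proof.
rewrite -addnS big_split_ord /= addrC -addrA; congr (_ + _).
rewrite big_ord_recl subn0 addrAC subrr add0r.
rewrite (reindex_inj rev_ord_inj) /=; apply: eq_bigr => k _.
by congr F; have := ltn_ord k; rewrite /bump; lia.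
Qed.

(** In Rothe's sum the central term j = n has exponent t n + s C(n, 2) + s n n, the K of
    [finite_jtp]. The terms j = n + k, and j = n - k in the next lemma, exceed it by the exponents
    of the two half theta series. *)
Lemma jtp_exponent_up s t n k : (k <= n)%N ->
  (s * 'C(n + k, 2) + (t * (n + k) + s * n * (n - k)) =
   t * n + s * 'C(n, 2) + s * n * n + hexp s t k)%N.
Proof. by rewrite /hexp => /subnKC; move: (n - k)%N => d <-; rewrite !binD2; nia. Qed.

Lemma jtp_exponent_down t t' n k : let s := (t + t')%N in (k <= n)%N ->
  (s * 'C(n - k, 2) + (t * (n - k) + s * n * (n + k)) =
   t * n + s * 'C(n, 2) + s * n * n + hexp s t' k)%N.
Proof.
rewrite /hexp => /= /subnKC; move: (n - k)%N => d <-; rewrite binD2.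
by have := bin2_sqr k; nia.
Qed.

(* Rothe's identity with 2n factors, x = q^t and y = q^(s n): the homogeneous form
   avoids negative powers of q, at the price of a common factor q^K. *)
Lemma finite_jtp t t' n :
  let s := (t + t')%N in
  qpoch (-1) s t n * qpoch (-1) s t' n =
  \sum_(k < n.+1) qbin (q ^+ s) (n + n) (n + k) * q ^+ hexp s t k
  + \sum_(k < n.+1) qbin (q ^+ s) (n + n) (n - k) * q ^+ hexp s t' k
  - qbin (q ^+ s) (n + n) n.
Proof.
move=> s; pose K := (t * n + s * 'C(n, 2) + s * n * n)%N.
have fE e : qfac (-1 : R) e = 1 + q ^+ e.
  by rewrite /qfac rmorphN rmorph1 mulN1r opprK.
apply: (@psXn_inj _ K).
have := rothe (q ^+ s) (q ^+ t) (q ^+ (s * n)) (n + n).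
rewrite (big_ord_sym (fun j => qbin (q ^+ s) (n + n) j * (q ^+ s) ^+ 'C(j, 2) *
  (q ^+ t) ^+ j * (q ^+ (s * n)) ^+ (n + n - j)) n) => rotheE.
transitivity (\prod_(k < n + n) (q ^+ (s * n) + q ^+ t * (q ^+ s) ^+ k)).
  (* The first n factors, read backwards, give the product for t', and the last n give the product
     for t; the powers of q pulled out multiply to q^K. *)
  rewrite big_split_ord /= (reindex_inj rev_ord_inj) /=.
  transitivity (\prod_(k < n) (q ^+ (t + s * (n - k.+1)) * qfac (-1) (s * k + t'))
     * \prod_(k < n) (q ^+ (s * n) * qfac (-1) (s * k + t))).
    rewrite !big_split /= mulrACA [qpoch _ _ t _ * _]mulrC; congr (_ * _).
    rewrite prodr_const card_ord -exprM /K exprD; congr (_ * _).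
    elim: (n) => [|m IH]; first by rewrite !muln0 big_ord0.
    rewrite big_ord_recl subSS subn0 binS2 mulnDr mulnS.
    rewrite [LHS](_ : _ = q ^+ (t + s * m) * q ^+ (t * m + s * 'C(m, 2))).
      by rewrite IH; congr (_ * _); apply: eq_bigr => i _.
    by rewrite -exprD; congr (_ ^+ _); lia.
  congr (_ * _); apply: eq_bigr => k _; rewrite fE mulrDr mulr1 -!exprM -!exprD.
    rewrite addrC; congr (_ ^+ _ + _ ^+ _).
    by have := ltn_ord k; rewrite /s; nia.
  by congr (_ + _ ^+ _); lia.
rewrite rotheE /= mulrBr mulrDr; congr (_ + _ - _).
- rewrite mulr_sumr; apply: eq_bigr => k _.
  rewrite mulrCA -!mulrA -!exprM -!exprD; congr (_ * _ ^+ _).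
  have := ltn_ord k; rewrite ltnS => le_kn.
  have -> : (n + n - (n + k) = n - k)%N by lia.
  exact: jtp_exponent_up.
- rewrite mulr_sumr; apply: eq_bigr => k _.
  rewrite mulrCA -!mulrA -!exprM -!exprD; congr (_ * _ ^+ _).
  have := ltn_ord k; rewrite ltnS => le_kn.
  have -> : (n + n - (n - k) = n + k)%N by lia.
  exact: jtp_exponent_down.
rewrite [RHS]mulrC -!mulrA -!exprM -!exprD; congr (_ * _ ^+ _).
by rewrite addnK /K; lia.
Qed.

Lemma qpoch1E s m : qpoch 1 s s m = \prod_(k < m) (1 - (q ^+ s) ^+ k.+1).
Proof.
apply: eq_bigr => k _.
by rewrite /qfac rmorph1 mul1r -exprM mulnS addnC.
Qed.

(** Near the middle of row 2n both lower factorials tend to [Eta s], as does the upper one, so the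
    Gaussian binomial tends to 1 / [Eta s]. *)
Lemma cvg_qbin s (e : nat -> nat) k : (0 < s)%N ->
    (forall n, (k <= n)%N -> (n <= e n + k /\ e n <= n + k)%N) ->
  cvg (fun n => Eta R s * qbin (q ^+ s) (n + n) (e n)) 1.
Proof.
move=> s0 he N; exists (N + k)%N => n le_n.
have [|e1 e2] := he n; first by lia.
have := @qbin_fact _ (q ^+ s) (n + n) (e n).
rewrite -!qpoch1E => -/(_ _)h.
have {}h := h ltac:(lia).
have pE m : (N <= m)%N -> eqm N (qpoch 1 s s m) (Eta R s) by apply: qpoch_eqm.
apply: (eqm_mulI (Eta0 R s0)); rewrite mulr1.
apply: eqm_trans (pE (n + n)%N ltac:(lia)); rewrite -h.
rewrite mulrA mulrC -mulrA; apply: eqm_mull.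
by apply: eqmM; apply: eqm_sym; apply: pE; lia.
Qed.

(** The limit of [finite_jtp] multiplied by [Eta s]: each binomial weight then tends to 1, and the
    termwise limit is justified by [cvg_isum_weight]. *)
Lemma jacobi_triple t t' : (0 < t)%N -> (0 < t')%N ->
  let s := (t + t')%N in
  ptheta s t + ptheta s t' - 1 = qpinf (-1) s t * qpinf (-1) s t' * Eta R s.
Proof.
move=> t0 t'0 s; have s0 : (0 < s)%N by rewrite addn_gt0 t0.
have h1 := cvgM (cvg_cst (Eta R s))
  (cvgM (qpoch_cvg (-1 : R) t s0) (qpoch_cvg (-1 : R) t' s0)).
rewrite [RHS]mulrC; apply: cvg_uniq h1.
have w1 k : cvg (fun n => Eta R s * qbin (q ^+ s) (n + n) (n + k)) 1.
  by apply: (@cvg_qbin _ _ k) => // n; lia.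
have w2 k : cvg (fun n => Eta R s * qbin (q ^+ s) (n + n) (n - k)) 1.
  by apply: (@cvg_qbin _ _ k) => // n; lia.
have w3 : cvg (fun n => Eta R s * qbin (q ^+ s) (n + n) n) 1.
  by apply: (@cvg_qbin _ _ 0) => // n; lia.
apply: cvg_ext (cvgD (cvgD
  (cvg_isum_weight (fun k => @ptheta_eqm0 s t k t0) w1)
  (cvg_isum_weight (fun k => @ptheta_eqm0 s t' k t'0) w2)) (cvgN w3)) => n.
rewrite /= finite_jtp mulrBr mulrDr !mulr_sumr.
by congr (_ + _ - _); apply: eq_bigr => k _; rewrite mulrA.
Qed.

(** Put k = r i + j and use C(r i + j, 2) = r^2 C(i, 2) + C(r, 2) i + r i j + C(j, 2). *)
Lemma ptheta_split r s t : (0 < r)%N -> (0 < t)%N ->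
  ptheta s t = \sum_(j < r) q ^+ hexp s t j *
    ptheta (r * r * s) (s * 'C(r, 2) + r * s * j + r * t).
Proof.
move=> r0 t0.
have h := cvg_sub (fun m => leq_pmull m r0)
  (cvg_isum (fun k => @ptheta_eqm0 s t k t0)).
apply: cvg_uniq h _.
pose F j k := q ^+ hexp s t j *
  q ^+ hexp (r * r * s) (s * 'C(r, 2) + r * s * j + r * t) k.
apply: (@cvg_ext _ (fun m => \sum_(j < r) \sum_(k < m) F j k)) => [m /=|].
  rewrite (big_ord_mul _ _ _ (fun k => q ^+ hexp s t k)).
  apply: eq_bigr => j _; apply: eq_bigr => k _.
  rewrite /F -exprD; congr (_ ^+ _); rewrite /hexp binD2.
  have -> : 'C(r * k, 2) = (r * r * 'C(k, 2) + 'C(r, 2) * k)%N.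
    elim: (nat_of_ord k) => [|m' IH]; first by rewrite !muln0.
    by rewrite mulnS addnC binD2 IH binS2; nia.
  nia.
apply: (@cvg_sum _ r (fun m j => \sum_(k < m) F j k)
  (fun j => q ^+ hexp s t j *
    ptheta (r * r * s) (s * 'C(r, 2) + r * s * j + r * t))) => j.
apply: (cvg_ext (u := fun m => q ^+ hexp s t j * \sum_(k < m) q ^+
  hexp (r * r * s) (s * 'C(r, 2) + r * s * j + r * t) k)) => [m|].
  by rewrite mulr_sumr.
apply: cvgM; first exact: cvg_cst.
by apply: cvg_isum => k; apply: ptheta_eqm0; nia.
Qed.

(** Removing the term k = 0 shifts t by s. Read backwards, it brings a parameter larger than s, as
    produced by [ptheta_split], back below s. *)
Lemma pthetaS s t : (0 < t)%N -> ptheta s t = 1 + q ^+ t * ptheta s (s + t).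
Proof.
move=> t0.
have h := cvg_sub leqnSn (cvg_isum (fun k => @ptheta_eqm0 s t k t0)).
apply: cvg_uniq h _.
have st0 : (0 < s + t)%N by lia.
apply: cvg_ext (cvgD (cvg_cst 1) (cvgM (cvg_cst (q ^+ t))
  (cvg_isum (fun k => @ptheta_eqm0 s (s + t) k st0)))) => m.
rewrite /= big_ord_recl /hexp /= bin0n !muln0 expr0 mulr_sumr; congr (_ + _).
apply: eq_bigr => k _; rewrite -exprD; congr (_ ^+ _).
by rewrite /bump /= add1n binS2; lia.
Qed.

Lemma psdilate_ptheta k s t : (0 < k)%N -> (0 < t)%N ->
  psdilate k (ptheta s t) = ptheta (k * s) (k * t).
Proof.
case: k => // k _ t0.
have h := cvg_dilate k.+1 (cvg_isum (fun k => @ptheta_eqm0 s t k t0)).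
apply: cvg_uniq h _.
have kt0 : (0 < k.+1 * t)%N by lia.
apply: cvg_ext (cvg_isum (fun i => @ptheta_eqm0 (k.+1 * s) _ i kt0)) => m.
rewrite /= rmorph_sum; apply: eq_bigr => i _.
by rewrite rmorphXn /= psdilateX -exprM /hexp mulnDr !mulnA.
Qed.
End JacobiTriple.

(** * The 3-dissection *)

Section Dissection.
Variable R : comNzRingType.
Local Notation q := (psX R).
Local Notation E := (Eta R).
Local Notation N := (qpinf (-1 : R) 2 1).
Local Notation N3 := (psdilate 3 N).
Local Notation odd_eta := (qpinf (1 : R) 2 1).

(* In Ramanujan's notation, Omega(q) = f(q, q^5) and Pser(q) = f(q, q^2). *)
Definition phi : ps R := ptheta R 2 1 + ptheta R 2 1 - 1.
Definition psi : ps R := ptheta R 1 1.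
Definition Omega : ps R := ptheta R 6 1 + ptheta R 6 5 - 1.
Definition Pser : ps R := ptheta R 3 1 + ptheta R 3 2 - 1.

(** Squares are 0 or 1 modulo 3. The indices divisible by 3 give phi(q^9); the residues 1 and 2
    supply the two halves of [Omega] at q^3. *)
Lemma phi_dissection :
  phi = psdilate 3 (psdilate 3 phi) + 2%:R * q * psdilate 3 Omega.
Proof.
rewrite /phi /Omega !rmorphB !rmorphD !rmorph1 /= !psdilate_ptheta //.
have -> : ptheta R 2 1 =
    ptheta R 18 9 + q * ptheta R 18 15 + q ^+ 4 * ptheta R 18 21.
  rewrite (@ptheta_split _ 3) // !big_ord_recr big_ord0 /= add0r.
  by rewrite -[hexp 2 1 0]/0%N -[hexp 2 1 1]/1%N -[hexp 2 1 2]/4%N mul1r expr1.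
rewrite -[(3 * (3 * 2))%N]/18%N -[(3 * (3 * 1))%N]/9%N.
rewrite -[(3 * 5)%N]/15%N -[(3 * 1)%N]/3%N.
rewrite (@pthetaS _ 18 3) // -[(18 + 3)%N]/21%N.
ring.
Qed.

(** In the sum of q^(k(k+1)/2), the indices k = 3i + 1 have exponent 9 i(i+1)/2 + 1 and give q
    psi(q^9); the residues 0 and 2 supply the two halves of [Pser] at q^3. *)
Lemma psi_dissection :
  psi = psdilate 3 Pser + q * psdilate 3 (psdilate 3 psi).
Proof.
rewrite /psi /Pser !rmorphB !rmorphD !rmorph1 /= !psdilate_ptheta //.
rewrite -[(3 * 3)%N]/9%N -[(3 * 1)%N]/3%N -[(3 * 2)%N]/6%N.
rewrite (@ptheta_split _ 3 1 1) // !big_ord_recr big_ord0 /= add0r.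
rewrite -[hexp 1 1 0]/0%N -[hexp 1 1 1]/1%N -[hexp 1 1 2]/3%N mul1r expr1.
rewrite (@pthetaS _ 9 3) //.
rewrite -[(9 + 3)%N]/12%N -[(3 * 3 * 1)%N]/9%N.
rewrite -[(1 * 'C(3, 2) + 3 * 1 * 0 + 3 * 1)%N]/6%N.
rewrite -[(1 * 'C(3, 2) + 3 * 1 * 1 + 3 * 1)%N]/9%N.
ring.
Qed.

Lemma qpinf_even_odd a s t : (0 < s)%N ->
  qpinf (a : R) s t = qpinf a (2 * s) t * qpinf a (2 * s) (s + t).
Proof.
move=> s0; rewrite (@qpinf_split _ 2) // !big_ord_recr big_ord0 /= mul1r.
by rewrite muln0 muln1.
Qed.

Lemma N_E1_E4 : N * E 1 * E 4 = E 2 ^+ 2.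
Proof.
have h1 : E 1 = odd_eta * E 2 by rewrite [LHS]qpinf_even_odd.
have h2 : E 2 = qpinf 1 4 2 * E 4 by rewrite [LHS]qpinf_even_odd.
have h3 : odd_eta * N = qpinf 1 4 2 by rewrite qpinfNM // expr1n.
by rewrite h1 expr2 {3}h2 -h3; ring.
Qed.

Lemma N3_E3_E12 : N3 * E 3 * E 12 = E 6 ^+ 2.
Proof.
have := congr1 (psdilate 3) N_E1_E4.
by rewrite rmorphXn !rmorphM /= !psdilate_Eta.
Qed.

Lemma phiE : phi = N ^+ 2 * E 2.
Proof. by rewrite /phi (@jacobi_triple _ 1 1). Qed.

(** Splitting by the parity of the index turns the one-sided series psi into the two-sided f(q,
    q^3), to which the triple product applies. *)
Lemma psiE : psi = N * E 4.
Proof.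
rewrite [N]qpinf_even_odd // -(@jacobi_triple _ 1 3) // /psi.
rewrite (@ptheta_split _ 2) // !big_ord_recr big_ord0 /= add0r.
rewrite (@pthetaS _ 4 1) // -[hexp 1 1 0]/0%N -[hexp 1 1 1]/1%N mul1r expr1.
rewrite -[(2 * 2 * 1)%N]/4%N -[(1 * 'C(2, 2) + 2 * 1 * 0 + 2 * 1)%N]/3%N.
rewrite -[(1 * 'C(2, 2) + 2 * 1 * 1 + 2 * 1)%N]/5%N -[(1 + 3)%N]/4%N.
ring.
Qed.

(** The factors of (-q; q^2) with exponents 1 and 5 modulo 6 come from [Omega]; those with exponent
    3 modulo 6 form [N3]. *)
Lemma OmegaE : Omega * N3 = N * E 6.
Proof.
rewrite /Omega (@jacobi_triple _ 1 5) // psdilate_qpinf //.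
rewrite [N](@qpinf_split _ 3) // !big_ord_recr big_ord0 /= mul1r.
by rewrite muln0 -[(2 * 1 + 1)%N]/3%N -[(2 * 2 + 1)%N]/5%N -[(3 * 1)%N]/3%N; ring.
Qed.

(** Here (-q; q^3)(-q^2; q^3) is (-q; q) without its factors at multiples of 3, and (-q^s; q^s) is
    E(2s) / E(s). *)
Lemma PserE : Pser * E 6 * E 1 = E 2 * E 3 ^+ 2.
Proof.
have h s : (0 < s)%N -> E s * qpinf (-1) s s = E (2 * s).
  by move=> s0; rewrite /Eta qpinfNM // expr1n.
rewrite -(h 3) // -(h 1%N) // /Pser (@jacobi_triple _ 1 2) //.
rewrite [qpinf (-1) 1 1](@qpinf_split _ 3) // !big_ord_recr big_ord0 /= mul1r.
by rewrite -[(1 * 1 + 1)%N]/2%N -[(1 * 2 + 1)%N]/3%N; ring.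
Qed.

Lemma N0 : N 0 = 1. Proof. exact: qpinf0. Qed.
Lemma N30 : N3 0 = 1. Proof. by rewrite psdilate_qpinf // qpinf0. Qed.

Lemma psneg_even k : (0 < k)%N -> ~~ odd k -> psneg (E k) = E k.
Proof. by move=> k0 ek; rewrite psneg_qpinf // mulr1 -signr_odd (negPf ek). Qed.

Lemma psneg_E1 : psneg (E 1) = N * E 2.
Proof.
by rewrite [E 1]qpinf_even_odd // rmorphM /= psneg_even // psneg_qpinf // mulr1 expr1.
Qed.

Lemma psneg_E3 : psneg (E 3) = N3 * E 6.
Proof.
rewrite -(@psdilate_Eta _ 3 1) // psneg_dilate // psneg_E1 rmorphM /=.
by rewrite psdilate_Eta.
Qed.

Lemma psneg_psi : psneg psi = odd_eta * E 4.
Proof.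
by rewrite psiE rmorphM /= psneg_even // psneg_qpinf // expr1 mulrNN mulr1.
Qed.

Lemma psneg_Pser : psneg Pser * N = N3 ^+ 2 * E 6.
Proof.
have := congr1 (@psneg R) PserE.
rewrite expr2 !rmorphM /= psneg_E1 psneg_E3 !psneg_even // => h.
apply: (psmulI (Eta0 R (isT : 0 < 2)%N)); apply: (psmulI (Eta0 R (isT : 0 < 6)%N)).
transitivity (psneg Pser * E 6 * (N * E 2)); first by ring.
by rewrite h; ring.
Qed.

Lemma psneg_psi3 : psdilate 3 (psneg psi) * N3 = E 6.
Proof.
have h : psneg psi * N = E 2.
  rewrite psneg_psi [RHS]qpinf_even_odd // mulrAC; congr (_ * _).
  by rewrite qpinfNM // expr1n.
by rewrite -rmorphM h /= psdilate_Eta.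
Qed.

Lemma phi_psneg_psi : phi * psneg psi = N * E 2 ^+ 2.
Proof.
have h : psneg psi * N = E 2.
  rewrite psneg_psi [RHS]qpinf_even_odd // mulrAC; congr (_ * _).
  by rewrite qpinfNM // expr1n.
transitivity (N * E 2 * (psneg psi * N)); first by rewrite phiE; ring.
by rewrite h; ring.
Qed.

Lemma phi3E : psdilate 3 phi = N3 ^+ 2 * E 6.
Proof. by rewrite phiE rmorphM rmorphXn /= psdilate_Eta. Qed.

Lemma psaddE (f g : ps R) : psadd f g = f + g. Proof. by []. Qed.
Lemma psmulE (f g : ps R) : psmul f g = f * g. Proof. by []. Qed.

Lemma ps_quotientE (a b c d : ps R) :
  b 0 = 1 -> a * c = d * b -> a * psinv b * c = d.
Proof. by move=> b0 h; rewrite mulrAC h -mulrA psmulV // mulr1. Qed.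

Lemma M2_03E : M2_03 R * E 2 = psdilate 3 phi * psneg Pser.
Proof.
rewrite /M2_03 !pspowE !psmulE; apply: ps_quotientE.
  by rewrite !(psM0E, psX0E) !Eta0 // !expr1n !mulr1.
(* The factor [N] absorbs E1 E4 on the left and turns [psneg Pser] into a product on the right. *)
apply: (psmulI N0); rewrite phi3E.
transitivity (E 6 ^+ 10 * E 2 * (N * E 1 * E 4)); first by ring.
rewrite N_E1_E4; transitivity
  (N3 ^+ 2 * E 6 * (psneg Pser * N) * (E 12 * E 3) ^+ 4 * E 2 ^+ 3); last by ring.
rewrite psneg_Pser.
transitivity ((N3 * E 3 * E 12) ^+ 4 * E 6 ^+ 2 * E 2 ^+ 3); last by ring.
by rewrite N3_E3_E12; ring.
Qed.

Lemma Omega_Pser : Omega * psneg Pser = N3 * E 6 ^+ 2.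
Proof.
apply: (psmulI N0); apply: (psmulI N30).
transitivity ((Omega * N3) * (psneg Pser * N)); first by ring.
by rewrite OmegaE psneg_Pser; ring.
Qed.

Lemma M2_13E : M2_13 R * E 2 =
  2%:R * Omega * psneg Pser - psdilate 3 phi * psdilate 3 (psneg psi).
Proof.
(* This is also the value of [Omega * psneg Pser], so two copies minus one leave a single copy. *)
have -> : psdilate 3 phi * psdilate 3 (psneg psi) = N3 * E 6 ^+ 2.
  rewrite phi3E; transitivity (N3 * E 6 * (psdilate 3 (psneg psi) * N3)).
    by ring.
  by rewrite psneg_psi3; ring.
rewrite -mulrA Omega_Pser.
rewrite /M2_13 !pspowE !psmulE; apply: ps_quotientE.
  by rewrite !(psM0E, psX0E) !Eta0 // !mulr1.
transitivity (E 6 ^+ 2 * (N3 * E 3 * E 12) * E 2); last by ring.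
by rewrite N3_E3_E12; ring.
Qed.

Lemma M2_23E : M2_23 R * E 2 = - 2%:R * Omega * psdilate 3 (psneg psi).
Proof.
rewrite /M2_23 psscaleE !pspowE !psmulE mulrA; apply: ps_quotientE.
  by rewrite !(psM0E, psX0E) !Eta0 // !expr1n !mulr1.
(* One [N3] is for [Omega], the other for psi(-q^3); on the left the two turn E3^2 E12^2 into
   E6^4. *)
rewrite rmorphN rmorph_nat; apply: (psmulI N30); apply: (psmulI N30).
transitivity (- 2%:R * (N3 * E 3 * E 12) ^+ 2 * E 2 ^+ 2); first by ring.
rewrite N3_E3_E12.
transitivity (- 2%:R * (Omega * N3) * (psdilate 3 (psneg psi) * N3)
  * E 6 ^+ 2 * E 4 * E 1); last by ring.
rewrite OmegaE psneg_psi3 -N_E1_E4; ring.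
Qed.

Lemma three_dissection :
  (psadd (psadd (psdilate 3 (M2_03 R)) (psshift 1 (psdilate 3 (M2_13 R))))
     (psshift 2 (psdilate 3 (M2_23 R)))) * E 6 = N * E 2 ^+ 2.
Proof.
rewrite -phi_psneg_psi {1}phi_dissection.
(* Under q -> -q the factor q in the dissection of psi changes sign, which accounts for the minus
   signs in the last two components. *)
have := congr1 (@psneg R) psi_dissection.
rewrite rmorphD rmorphM /= psnegX !psneg_dilate // => ->.
rewrite !psshiftE !psaddE !mulrDl -!mulrA.
rewrite -(@psdilate_Eta _ 3 2) // -!rmorphM M2_03E M2_13E M2_23E.
rewrite !(rmorphB, rmorphM, rmorphN, rmorph_nat) /=.
ring.
Qed.
End Dissection.

(** * Specialization at a cube root of unity *)

Section Map.
Variables (A B : comNzRingType) (ev : {rmorphism A -> B}).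

Definition psmap (f : ps A) : ps B := fun n => ev (f n).

Lemma psmapM (f g : ps A) : psmap (f * g) = psmap f * psmap g.
Proof.
apply: funext => n; rewrite /psmap !psME rmorph_sum.
by apply: eq_bigr => i _; rewrite rmorphM.
Qed.

Lemma psmap1 : psmap 1 = 1.
Proof. by apply: funext => n; rewrite /psmap !ps1E rmorph_nat. Qed.

Lemma psmapV (f : ps A) : f 0 = 1 -> psmap (psinv f) = psinv (psmap f).
Proof.
move=> f0; apply: psinv_eq; first by rewrite /psmap f0 rmorph1.
by rewrite -psmapM psmulV // psmap1.
Qed.

Lemma psmap_qpinf a s t : psmap (qpinf a s t) = qpinf (ev a) s t.
Proof.
apply: funext => n; rewrite /psmap /qpinf -coef_map rmorph_prod.
rewrite (eq_bigr (fun k : 'I_n.+1 => 1 - ev a *: 'X^(s * k + t))) // => k _ /=.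
by rewrite rmorphB rmorph1 /= map_polyZ map_polyXn.
Qed.
End Map.

(** * Degree bounds in z and w *)

Section Degrees.

(* These bounds ensure that every monomial z^a w^b of the coefficient of q^n has
   |a - b| <= n, so that a sum over |m| <= N with n <= N misses none of them. *)
Definition bidegree_le n (P : R2) :=
  (size P <= n.+1)%N /\ forall a, (size (P`_a)%R <= n.+1)%N.

Lemma bidegreeW m n P : (m <= n)%N -> bidegree_le m P -> bidegree_le n P.
Proof.
by move=> le_mn [h1 h2]; split=> [|a]; [have := h1 | have := h2 a]; lia.
Qed.

Lemma bidegree0 n : bidegree_le n 0.
Proof. by split=> [|a]; rewrite ?coef0 size_poly0. Qed.

Lemma bidegree1 n : bidegree_le n 1.
Proof.
split=> [|a]; first by rewrite size_poly1.
by rewrite coef1; case: (a == _); rewrite ?size_poly1 ?size_poly0.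
Qed.

Lemma bidegreeN n P : bidegree_le n P -> bidegree_le n (- P).
Proof. by move=> [h1 h2]; split=> [|a]; rewrite ?coefN size_polyN. Qed.

Lemma bidegreeD n P Q :
  bidegree_le n P -> bidegree_le n Q -> bidegree_le n (P + Q).
Proof.
move=> [h1 h2] [k1 k2]; split=> [|a]; rewrite ?coefD.
  by apply: leq_trans (size_polyD _ _) _; rewrite geq_max h1.
by apply: leq_trans (size_polyD _ _) _; rewrite geq_max h2 k2.
Qed.

Lemma bidegree_sum n (I : Type) (r : seq I) (F : I -> R2) :
  (forall i, bidegree_le n (F i)) -> bidegree_le n (\sum_(i <- r) F i).
Proof.
move=> hF; elim/big_ind: _ => // [|P Q]; [exact: bidegree0|exact: bidegreeD].
Qed.

Lemma bidegreeM m n P Q :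
  bidegree_le m P -> bidegree_le n Q -> bidegree_le (m + n) (P * Q).
Proof.
move=> [h1 h2] [k1 k2]; split=> [|a].
  by apply: leq_trans (size_polyMleq _ _) _; lia.
rewrite coefM; apply: leq_trans (size_sum _ _ _) _; apply/bigmax_leqP => i _.
apply: leq_trans (size_polyMleq _ _) _.
by have := h2 i; have := k2 (a - i)%N; lia.
Qed.

Definition graded (f : ps R2) := forall n, bidegree_le n (f n).

Lemma gradedM f g : graded f -> graded g -> graded (f * g).
Proof.
move=> hf hg n; rewrite psME; apply: bidegree_sum => i.
by have := bidegreeM (hf i) (hg (n - i)%N); rewrite subnKC // leq_ord.
Qed.

Lemma gradedV f : graded f -> graded (psinv f).
Proof.
move=> hf; elim/ltn_ind => -[|n] IH; first exact: bidegree1.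
rewrite psinvS; apply/bidegreeN/bidegree_sum => j.
have lt_jn := ltn_ord j.
by have := bidegreeM (hf j.+1) (IH (n - j)%N ltac:(lia)); rewrite addSn subnKC.
Qed.

(** Each factor pairs one [a] with a power q^e where e >= t >= 1, so the degree in z and w never
    exceeds the degree in q. *)
Lemma graded_qpinf a s t : (0 < t)%N -> bidegree_le 1 a -> graded (qpinf a s t).
Proof.
move=> t0 ha n; suff : graded (qpoch a s t n.+1) by move/(_ n); rewrite qpoch_poly.
rewrite /qpoch; elim/big_ind: _ => [m||k _ m].
- by rewrite ps1E; case: m => [|m]; [apply: bidegree1|apply: bidegree0].
- exact: gradedM.
rewrite /qfac psBE psCE psXnE ps1E; apply: bidegreeD.
  by case: m => [|m]; [apply: bidegree1|apply: bidegree0].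
apply: bidegreeN; case: eqP => [->|_]; rewrite ?mulr1 ?mulr0.
  by apply: bidegreeW ha; lia.
exact: bidegree0.
Qed.

Lemma bidegree_zvar : bidegree_le 1 zvar.
Proof.
split=> [|a]; first by rewrite size_polyX.
by rewrite coefX; case: (a == _); rewrite ?size_poly1 ?size_poly0.
Qed.

Lemma bidegree_wvar : bidegree_le 1 wvar.
Proof.
split=> [|a]; first by apply: leq_trans (size_polyC_leq1 _) _.
by rewrite coefC; case: (a == _); rewrite ?size_polyX ?size_poly0.
Qed.

Lemma graded_M2gen : graded M2gen.
Proof.
have h1 : bidegree_le 1 (1 : R2) by apply: bidegree1.
have hN : bidegree_le 1 (-1 : R2) by apply: bidegreeN.
apply: gradedM; apply: gradedM; try apply: gradedV; apply: graded_qpinf => //.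
- exact: bidegree_zvar.
- exact: bidegree_wvar.
Qed.
End Degrees.

(** * Evaluation of the generating function at a point *)

Section Evaluation.
Variable (F : fieldType) (z : F).

(** The inner variable w goes to the inverse of z, so for nonzero z the monomial z^a w^b contributes
    z^(a-b) and the relation z w = 1 is respected by [ev2]. *)
Definition ev1 : {rmorphism {poly int} -> F} :=
  horner_eval z^-1 \o map_poly intr.
Definition ev2 : {rmorphism R2 -> F} := horner_eval z \o map_poly ev1.

Lemma ev2E P : ev2 P =
  \sum_(a < size P) \sum_(b < size P`_a) (P`_a`_b)%:~R * (z^-1 ^+ b * z ^+ a).
Proof.
rewrite -[LHS]/(map_poly ev1 P).[z] (@horner_coef_wide _ (size P)) ?size_poly //.
apply: eq_bigr => a _; rewrite coef_map.
rewrite -[X in X * _]/(map_poly intr (P`_a)).[z^-1].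
rewrite (@horner_coef_wide _ (size P`_a)) ?size_poly // mulr_suml.
by apply: eq_bigr => b _; rewrite coef_map /= mulrA.
Qed.

Lemma ev2_zvar : ev2 zvar = z.
Proof. by rewrite -[LHS]/(map_poly ev1 'X).[z] map_polyX hornerX. Qed.

Lemma ev2_wvar : ev2 wvar = z^-1.
Proof.
rewrite -[LHS]/(map_poly ev1 ('X)%:P).[z] map_polyC hornerC.
by rewrite -[LHS]/(map_poly intr 'X).[z^-1] map_polyX hornerX.
Qed.

Lemma M2_sum (n N : nat) : z != 0 -> (n <= N)%N ->
  \sum_(k < (2 * N).+1) (M2 (k%:Z - N%:Z) n)%:~R * z ^ (k%:Z - N%:Z)
  = ev2 (M2gen n).
Proof.
move=> z0 le_nN; have [hP hQ] := graded_M2gen n; rewrite ev2E.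
under eq_bigr => k _.
  rewrite /M2 rmorph_sum mulr_suml.
  under eq_bigr do rewrite rmorph_sum mulr_suml.
  over.
rewrite exchange_big; apply: eq_bigr => a _.
rewrite exchange_big; apply: eq_bigr => b _ /=.
have lt_a := ltn_ord a; have lt_b := ltn_ord b; have le_b := hQ a.
(* The monomial z^a w^b is counted for exactly one m, namely a - b, reached at k = a + N - b; this
   lies in the range because a, b <= n <= N. *)
have k0P : (a + N - b < (2 * N).+1)%N by lia.
rewrite (bigD1 (Ordinal k0P)) //= big1 => [|k ne_k]; last first.
  case: eqP => [e|_]; last by rewrite mul0r.
  by case/eqP: ne_k; apply: val_inj => /=; lia.
have -> : (a + N - b)%N%:Z - N%:Z = a%:Z - b%:Z by lia.
rewrite eqxx addr0 expfzDr // -exprnN exprVn; congr (_ * _).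
by rewrite mulrC.
Qed.
End Evaluation.

Lemma primitive_cube_root (F : fieldType) (z : F) :
  3.-primitive_root z -> [/\ z != 0, 1 + z + z ^+ 2 = 0 & z^-1 = z ^+ 2].
Proof.
move=> hz; have z3 := prim_expr_order hz.
have z0 : z != 0.
  by apply/eqP => z_0; move/eqP: z3; rewrite z_0 expr0n eq_sym oner_eq0.
have z1 : z - 1 != 0.
  by rewrite subr_eq0 -(expr1 z) -(prim_order_dvd hz).
split=> //.
  apply: (mulfI z1); rewrite mulr0 (_ : _ * _ = z ^+ 3 - 1); last by ring.
  by rewrite z3 subrr.
by apply: (mulfI z0); rewrite divff // -exprS z3.
Qed.

(** The window -N <= m <= N with N >= n already contains every m for which [M2 m n] is nonzero, so
    the finite sum is the full sum over m. *)
Theorem theorem2p11 (zeta : algC) (hz : 3.-primitive_root zeta) (n N : nat) :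
  (n <= N)%N ->
  \sum_(k < (2 * N).+1) (M2 (k%:Z - N%:Z) n)%:~R * zeta ^ (k%:Z - N%:Z)
  = psadd (psadd (psdilate 3 (M2_03 algC))
                 (psshift 1 (psdilate 3 (M2_13 algC))))
          (psshift 2 (psdilate 3 (M2_23 algC))) n.
Proof.
have [z0 z2 zV] := primitive_cube_root hz.
move=> le_nN; rewrite M2_sum //.
rewrite -[LHS]/(psmap (ev2 zeta) M2gen n); congr (_ n).
apply: (psmulI (Eta0 _ (isT : 0 < 6)%N)); rewrite [RHS]mulrC three_dissection.
rewrite /M2gen !psmulE !psmapM !psmapV ?qpinf0 // !psmap_qpinf.
rewrite ev2_zvar ev2_wvar zV rmorphN rmorph1 -/(Eta _ 2).
(* The cyclotomic factorization of E6 supplies the two products whose inverses occur in the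
   generating function. *)
rewrite -[Eta algC 6](@qpinf_cube _ zeta 2 2) // -/(Eta _ 2).
have inv w : qpinf w 2 2 * psinv (qpinf w 2 2) = 1 :> ps algC.
  by rewrite psmulV // qpinf0.
(* Two unit factors are inserted on the right as product times inverse, so that both sides agree as
   polynomials in the series involved. *)
rewrite -[RHS]mul1r -[1 in RHS](mulr1 1) -{1}(inv zeta) -(inv (zeta ^+ 2)).
ring.
Qed.
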